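(* Suppose $C_0(\Sigma)=[\xi,\eta]$ and $a\ge\eta$. Let $n\ge1$ and, for $N>0$, let $x_{n,1}^N<\dots<x_{n,n}^N$ be the zeros of $p_n^N(a;x)$, let $x_{n,1}<\dots<x_{n,n}$ be the zeros of $p_n(x)$, and let $x_{n-1,1}^{**}<\dots<x_{n-1,n-1}^{**}$ be the zeros of $p_{n-1}^{**}(a;x)$. Then $$x_{n,1}<x_{n,1}^{N}<x_{n-1,1}^{**}<\cdots<x_{n,n-1}<x_{n,n-1}^{N}<x_{n-1,n-1}^{**}<x_{n,n}<x_{n,n}^{N}<a.$$ Moreover, each $x_{n,k}^{N}$ is an increasing function of $N$ and, for each $k=1,\dots,n-1$, $$\lim_{N\to\infty}x_{n,n}^{N}=a,\qquad \lim_{N\to\infty}x_{n,k}^{N}=x_{n-1,k}^{**},$$ and $$\lim_{N\to\infty}N[a-x_{n,n}^{N}]=\frac{p_n(a)}{B_n\,p_{n-1}^{**}(a;a)},$$ $$\lim_{N\to\infty}N[x_{n-1,k}^{**}-x_{n,k}^{N}]=\frac{p_n(x_{n-1,k}^{**})}{B_n\,(x_{n-1,k}^{**}-a)\,[p_{n-1}^{**}(a;x)]'_{x=x_{n-1,k}^{**}}},$$ where $B_n=K_{n-1}(a,a)$ and $'$ denotes $d/dx$.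
   Context: $\mu$ is a positive Borel measure on $\mathbb R$ whose support $\Sigma$ has infinitely many points, with all moments finite. $C_0(\Sigma)$ is the convex hull of $\Sigma$. $\{p_n(x)\}_{n\ge0}$ is the sequence of monic orthogonal polynomials for $\mu$, with $\|p\|_\mu^2=\int p^2d\mu$, and $K_n(x,y)=\sum_{j=0}^n p_j(x)p_j(y)/\|p_j\|_\mu^2$. $\{p_n^{**}(a;x)\}_{n\ge0}$ is the sequence of monic orthogonal polynomials for $(x-a)^2d\mu(x)$. $\{p_n^{N}(a;x)\}_{n\ge0}$ is the sequence of monic orthogonal polynomials for $d\mu+N\delta_a$, with $\delta_a$ the unit point mass at $a$. *)

(* Defs.v *)
From HB Require Import structures.
From mathcomp Require Import all_boot all_order all_algebra.
From mathcomp Require Import polyrcf.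
From mathcomp Require Import all_classical all_reals all_analysis.
From mathcomp Require Import measurable_realfun.

Set Implicit Arguments.
Unset Strict Implicit.
Unset Printing Implicit Defensive.

Import Order.TTheory GRing.Theory Num.Theory.
Import numFieldNormedType.Exports.

Local Open Scope classical_set_scope.
Local Open Scope ring_scope.

Section measures_on_the_line.
Variable R : realType.
Implicit Types (mu : {measure set R -> \bar R}) (a : R).

Definition measure_support mu : set R :=
  [set x | forall U : set R, open U -> U x -> (0 < mu U)%E].

Definition convex_hull (A : set R) : set R :=
  smallest (@convex_set R R^o) A.

(* The case n = 0 makes mu a finite measure. *)
Definition finite_moments mu : Prop :=
  forall n : nat, mu.-integrable setT (fun x => (x ^+ n)%:E).

Definition add_mass mu a (N : {nonneg R}) : {measure set R -> \bar R} :=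
  measure_add mu (mscale N (dirac a)).

End measures_on_the_line.

Section square_weight.
Variables (R : realType) (mu : {measure set R -> \bar R}) (a : R).

Definition sq_weight (A : set R) : \bar R :=
  (\int[mu]_(x in A) ((x - a) ^+ 2)%:E)%E.

Let sq_weight0 : sq_weight set0 = 0%E.
Proof. by rewrite /sq_weight integral_set0. Qed.

Let sq_weight_ge0 A : (0 <= sq_weight A)%E.
Proof. by apply: integral_ge0 => x _; rewrite lee_fin sqr_ge0. Qed.

Let sq_weight_sigma_additive : semi_sigma_additive sq_weight.
Proof.
apply: semi_sigma_additive_nng_induced.
  apply/measurable_EFinP; apply: measurable_funX.
  exact: measurable_funB.
by move=> x; rewrite lee_fin sqr_ge0.
Qed.

HB.instance Definition _ := isMeasure.Build _ _ _ sq_weight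
  sq_weight0 sq_weight_ge0 sq_weight_sigma_additive.

End square_weight.

Section orthogonal_polynomials.
Variable R : realType.
Implicit Types (mu : {measure set R -> \bar R}) (p q : {poly R}).

Definition inner mu p q : R := \int[mu]_x (p.[x] * q.[x]).

Definition monic_OPS mu (P : nat -> {poly R}) : Prop :=
  [/\ forall n, size (P n) = n.+1,
      forall n, P n \is monic
    & forall m n, m <> n -> inner mu (P m) (P n) = 0].

Definition OPS_kernel mu (P : nat -> {poly R}) (n : nat) (x y : R) : R :=
  \sum_(j < n.+1) (P j).[x] * (P j).[y] / inner mu (P j) (P j).

(* zero_ p k is the k-th smallest real zero of p, counted from k = 1; it is
   meaningful only for 1 <= k <= size (rootsR p). *)
Definition zero_ p (k : nat) : R := (rootsR p)`_(k.-1).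

End orthogonal_polynomials.

(* Main.v *)
Require Import Defs.
From HB Require Import structures.
From mathcomp Require Import all_boot all_order all_algebra.
From mathcomp Require Import polyrcf.
From mathcomp Require Import all_classical all_reals all_analysis.
From mathcomp Require Import measurable_realfun.
From mathcomp Require Import ring lra.

(** The measure enters only through the functional [L q], the integral of the
    polynomial [q]: it is linear because the moments are finite, and it is
    positive on nonzero polynomials that are nonnegative on ]-oo, a], because
    the support is infinite, lies to the left of [a] and carries all the mass
    (lemma [moment_positive]).  Orthogonality for the two modified measures
    becomes orthogonality for [q |-> L ((X - a)^2 q)] and for
    [q |-> L q + N q(a)] ([inner_sq_weight], [inner_add_mass]).

    Write [P] for the [n]-th orthogonal polynomial of mu, [g] for the
    ([n]-1)-th one of (x - a)^2 dmu, a Christoffel transform of mu, and put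
    [Q = (X - a) g].  Two facts carry the proof.

    The zeros of [P] and [Q] interlace, a zero of [P] coming first.  Gauss
    quadrature with nodes at the zeros of [P] is exact up to degree 2n - 1, and
    [g] is orthogonal, with the weight (x - a)^2, to the product [r] of all
    factors of [P] but two, those of nodes [u] and [v].  This leaves
    l g(u) r(u) + m g(v) r(v) = 0 with l, m > 0.  Hence [g] vanishes at no
    node, as it would then vanish at all [n] of them, and it changes sign
    between consecutive ones ([christoffel_interlacing]).

    The monic orthogonal polynomial [W] of mu + N delta_a lies in the pencil of
    [P] and [Q]: (1 + N B) W = P + N B Q, where B = K(a, a)
    ([mass_point_pencil]).  Indeed [Q] is orthogonal to the polynomials of
    degree < n that vanish at [a], so L(Q r) = r(a) L(Q) for r of degree < n,
    and the reproducing property of the kernel K gives B L(Q) = - P(a).  With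
    this value the difference of the two sides, of degree < n, is orthogonal to
    itself for mu + N delta_a.

    The theorem is then about the pencil P + c Q with c > 0, for interlacing
    zeros x_k < y_k < x_{k+1}.  On ]x_k, y_k[ the polynomial [Q] has the sign
    opposite to P(y_k), so the pencil has opposite signs at x_k and y_k and a
    zero z_k(c) between them.  Raising c gives the pencil at the old
    zero the sign that it has at x_k, so z_k moves to the right.  At any given
    point of ]x_k, y_k[ the pencil has that sign once c is large, so z_k(c)
    tends to y_k.  Finally, writing Q = (X - y_k) T, the equation of z_k(c)
    reads c (y_k - z_k(c)) = P(z_k(c)) / T(z_k(c)), which tends to
    P(y_k) / Q'(y_k). *)

Set Implicit Arguments.
Unset Strict Implicit.
Unset Printing Implicit Defensive.

Import Order.TTheory GRing.Theory Num.Theory.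
Import numFieldNormedType.Exports.

Local Open Scope classical_set_scope.
Local Open Scope ring_scope.

(** * Lists of real roots *)

Section real_roots.
Variable R : rcfType.
Implicit Types (p q : {poly R}) (u v z : R).

Lemma mem_rootsR p z : p != 0 -> (z \in rootsR p) = root p z.
Proof. by move=> p0; rewrite -(roots_on_rootsR p0) in_itv. Qed.

Lemma sorted_rootsR p : sorted <%R (rootsR p).
Proof. exact: sorted_roots. Qed.

Lemma uniq_rootsR p : uniq (rootsR p).
Proof. exact: uniq_roots. Qed.

Lemma size_rootsR_lt p : p != 0 -> (size (rootsR p) < size p)%N.
Proof.
move=> p0; apply: max_poly_roots (uniq_rootsR p) => //.
by apply/allP => z; rewrite mem_rootsR.
Qed.

Lemma rootsR_mkseq p n (x : nat -> R) : size p = n.+1 ->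
  (forall k, (k < n)%N -> root p (x k)) ->
  (forall k, (k.+1 < n)%N -> x k < x k.+1) ->
  rootsR p = mkseq x n.
Proof.
move=> sp rx xx; have p0 : p != 0 by rewrite -size_poly_eq0 sp.
have sx : sorted <%R (mkseq x n).
  apply/(sortedP 0) => i; rewrite size_mkseq => ilt.
  by rewrite !nth_mkseq ?xx // ltnW.
apply: (irr_sorted_eq lt_trans ltxx (sorted_rootsR p) sx) => z.
apply/esym; apply: (uniq_min_size _ _ _).2.
- exact: sorted_uniq lt_trans ltxx _ sx.
- by move=> _ /mapP[k + ->]; rewrite mem_iota mem_rootsR //; exact: rx.
- by rewrite size_mkseq -ltnS -sp size_rootsR_lt.
Qed.

Lemma noroot_same_sign p u v : (forall z, ~~ root p z) -> 0 < p.[u] * p.[v].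
Proof.
move=> nr; wlog uv : u v / u <= v.
  by move=> H; case: (leP u v) => [|/ltW] uv; [|rewrite mulrC]; exact: H.
rewrite lt_def mulf_neq0 -?rootE //= leNgt; apply/negP => puv.
by have [z _ /idPn[]] := poly_ivtoo uv puv.
Qed.

(** Sign changes on [n] successive intervals exhaust the roots of a polynomial of
    degree [n], so that the [k]-th interval holds the [k]-th root.  This is how
    all the zeros below are located. *)
Lemma rootsR_in_intervals p n (l u : nat -> R) : size p = n.+1 ->
  (forall k, (k < n)%N -> l k < u k /\ p.[l k] * p.[u k] < 0) ->
  (forall k, (k.+1 < n)%N -> u k <= l k.+1) ->
  size (rootsR p) = n /\
  forall k, (k < n)%N -> l k < (rootsR p)`_k < u k.
Proof.
move=> sp lu ul; have p0 : p != 0 by rewrite -size_poly_eq0 sp.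
(* For [k < n] the sign change makes the list nonempty. *)
pose y k := head 0 [seq z <- rootsR p | l k < z < u k].
have yP k : (k < n)%N -> l k < y k < u k /\ root p (y k).
  move=> kn; have [luk pk] := lu k kn.
  have [z zi rz] := poly_ivtoo (ltW luk) pk.
  have : z \in [seq z <- rootsR p | l k < z < u k].
    by rewrite mem_filter mem_rootsR // rz andbT; move: zi; rewrite in_itv.
  rewrite /y; case E : [seq _ <- _ | _] => [//|h t] _ /=.
  have : h \in [seq z <- rootsR p | l k < z < u k] by rewrite E mem_head.
  by rewrite mem_filter mem_rootsR // => /andP.
have -> : rootsR p = mkseq y n.
  apply: rootsR_mkseq => // k kn; first by have [] := yP k kn.
  have [/andP[_ h1] _] := yP k (ltnW kn); have [/andP[h2 _] _] := yP _ kn.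
  exact: lt_trans (lt_le_trans h1 (ul k kn)) h2.
rewrite size_mkseq; split=> // k kn; rewrite nth_mkseq //.
by have [] := yP k kn.
Qed.

Lemma eq_rootsR p q : p != 0 -> q != 0 -> root p =1 root q ->
  rootsR p = rootsR q.
Proof.
move=> p0 q0 pq.
apply: (irr_sorted_eq lt_trans ltxx (sorted_rootsR p) (sorted_rootsR q)) => z.
by rewrite !mem_rootsR.
Qed.

Lemma rootsR_increasing p i j :
  (i < j)%N -> (j < size (rootsR p))%N -> (rootsR p)`_i < (rootsR p)`_j.
Proof.
move=> ij js; apply: (sorted_ltn_nth lt_trans) => //.
- exact: sorted_rootsR.
- by rewrite inE (ltn_trans ij).
Qed.

Lemma monic_prod_rootsR p n : p \is monic -> size p = n.+1 ->
  size (rootsR p) = n -> p = \prod_(i < n) ('X - ((rootsR p)`_i)%:P).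
Proof.
move=> mp sp sr; have p0 := monic_neq0 mp.
have -> : \prod_(i < n) ('X - ((rootsR p)`_i)%:P) =
    \prod_(z <- rootsR p) ('X - z%:P) by rewrite (big_nth 0) sr big_mkord.
rewrite [LHS](@all_roots_prod_XsubC _ p (rootsR p)) ?sp ?sr //.
- by rewrite (monicP mp) scale1r.
- by apply/allP => z; rewrite mem_rootsR.
- by rewrite uniq_rootsE uniq_rootsR.
Qed.

End real_roots.

(** * Polynomials orthogonal for a positive functional *)

Section positive_functionals.
Variables (R : rcfType) (a : R) (L : {scalar {poly R}}).
Implicit Types (p q r g : {poly R}) (u v z : R).

(** The properties of integration against a measure on ]-oo, a] with infinite
    support that the theory of zeros uses. *)
Definition positive_left := forall q, q != 0 ->
  (forall x, x <= a -> 0 <= q.[x]) -> 0 < L q.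

Definition orthogonal_upto n p := forall q, (size q <= n)%N -> L (p * q) = 0.

Hypothesis Lpos : positive_left.

Lemma functional_sqr_gt0 q : q != 0 -> 0 < L (q ^+ 2).
Proof.
move=> q0; apply: Lpos; first by rewrite expf_neq0.
by move=> x _; rewrite horner_exp sqr_ge0.
Qed.

(** L(p q) = L(s q^2) cannot vanish when [s] has a strict constant sign on
    ]-oo, a], by positivity. *)
Lemma orthogonal_cofactor_sign n p q s : orthogonal_upto n p ->
  (size q <= n)%N -> p = s * q -> q != 0 ->
  ~ (forall x y, x <= a -> y <= a -> 0 < s.[x] * s.[y]).
Proof.
move=> op sq ps q0 sgs.
have s0 : s != 0 by apply/eqP => s0; have := sgs a a; rewrite s0 horner0; lra.
have := op _ sq; rewrite ps -mulrA -expr2 => L0.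
have : 0 < L (s.[a] *: (s * q ^+ 2)).
  apply: Lpos.
    have sa0 : s.[a] != 0.
      by apply/eqP => sa; have := sgs a a (lexx _) (lexx _); rewrite sa; lra.
    by rewrite scaler_eq0 (negPf sa0) mulf_neq0 ?expf_neq0.
  move=> x xa; rewrite hornerZ hornerM horner_exp mulrA mulr_ge0 ?sqr_ge0 //.
  exact/ltW/sgs.
by rewrite linearZ /= L0 mulr0 ltxx.
Qed.

(** If [p = s (X - z)^2], then L(p s) = L((s (X - z))^2) would be positive. *)
Lemma orthogonal_root_simple n p z s : p \is monic -> size p = n.+1 ->
  orthogonal_upto n p -> p != s * ('X - z%:P) ^+ 2.
Proof.
move=> mp sp op; apply/eqP => ps.
have p0 : p != 0 by exact: monic_neq0.
have s0 : s != 0 by apply: contraNneq p0 => s0; rewrite ps s0 mul0r.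
have X0 : 'X - z%:P != 0 :> {poly R} by rewrite polyXsubC_eq0.
have szs : (size s).+2 = n.+1.
  by rewrite -sp ps expr2 mulrA !size_Mmonic ?monicXsubC ?mulf_neq0 // !size_XsubC !addn2.
have Ls : L (p * s) = 0 by apply: op; rewrite -ltnS -szs ltnS leqW.
have := @functional_sqr_gt0 (s * ('X - z%:P)) (mulf_neq0 s0 X0).
have -> : (s * ('X - z%:P)) ^+ 2 = p * s by rewrite ps; ring.
by rewrite Ls ltxx.
Qed.

(** The cofactor of the product of the roots has no root, because roots are
    simple; hence it has constant sign, and orthogonality forces it to be
    constant.  A root [z >= a] is impossible since, for [p = t (X - z)],
    L(p t) = L((X - z) t^2) would be negative. *)
Lemma orthogonal_all_roots n p : p \is monic -> size p = n.+1 ->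
  orthogonal_upto n p ->
  size (rootsR p) = n /\ {in rootsR p, forall z, z < a}.
Proof.
move=> mp sp op; have p0 : p != 0 by exact: monic_neq0.
set rs := rootsR p; pose q := \prod_(z <- rs) ('X - z%:P).
have mq : q \is monic by exact: monic_prod_XsubC.
have q0 : q != 0 by exact: monic_neq0.
have szq : size q = (size rs).+1 by rewrite size_prod_XsubC.
have [s ps] : exists s, p = s * q.
  apply/dvdpP; apply: uniq_roots_dvdp; last first.
    by rewrite uniq_rootsE uniq_rootsR.
  by apply/allP => z; rewrite mem_rootsR.
have nrs z : ~~ root s z.
  apply/negP => rsz.
  have : root p z by rewrite ps rootM rsz.
  rewrite -mem_rootsR // => zrs.
  have /factor_theorem[s1 es] := rsz.
  have : root q z by rewrite root_prod_XsubC.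
  move=> /factor_theorem[q1 eq1].
  have := orthogonal_root_simple z (s1 * q1) mp sp op.
  by rewrite ps es eq1 expr2 mulrACA eqxx.
have szr : size rs = n.
  apply/eqP; rewrite eqn_leq -[X in (X <= _)%N]/(size rs).
  rewrite -ltnS -sp size_rootsR_lt //= leqNgt; apply/negP => lt_rs.
  apply: (orthogonal_cofactor_sign op _ ps q0); first by rewrite szq.
  by move=> x y _ _; exact: noroot_same_sign.
split=> // z zrs; rewrite ltNge; apply/negP => az.
have : root p z by rewrite -mem_rootsR.
move=> /factor_theorem[t pt].
have t0 : t != 0 by apply: contraNneq p0 => t0; rewrite pt t0 mul0r.
have szt : (size t <= n)%N.
  by rewrite -ltnS -sp pt size_Mmonic ?monicXsubC // size_XsubC addn2.
have : 0 < L (t ^+ 2 * (z%:P - 'X)).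
  apply: Lpos; first by rewrite mulf_neq0 ?expf_neq0 // -opprB oppr_eq0 polyXsubC_eq0.
  move=> x xa; rewrite !hornerE mulr_ge0 ?sqr_ge0 //.
  by rewrite subr_ge0 (le_trans xa).
rewrite -[z%:P - 'X]opprB mulrN linearN /= expr2 mulrAC -pt op //.
by rewrite oppr0 ltxx.
Qed.

(** The weight of Gauss quadrature at the node [u], up to a positive factor:
    with [r] vanishing at the other nodes, r^2 - r(u) r is a multiple of [p], so
    L(r^2) = r(u) L(r). *)
Lemma lagrange_weight n u r p : p = ('X - u%:P) * r -> orthogonal_upto n p ->
  (size r <= n)%N -> r != 0 -> 0 < L r * r.[u].
Proof.
move=> pr op szr r0.
have /factor_theorem[t et] : root (r - r.[u]%:P) u.
  by rewrite rootE !hornerE subrr.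
have szt : (size t <= n)%N.
  have [-> | t0] := eqVneq t 0; first by rewrite size_poly0.
  have : (size (r - r.[u]%:P)%R <= n)%N.
    rewrite (leq_trans (size_polyD _ _)) // geq_max szr size_polyN.
    rewrite (leq_trans (size_polyC_leq1 _)) // (leq_trans _ szr) //.
    by rewrite size_poly_gt0.
  by rewrite et size_Mmonic ?monicXsubC // size_XsubC addn2 => /ltnW.
have := functional_sqr_gt0 r0.
have -> : r ^+ 2 = r.[u] *: r + p * t.
  have rE : r = r.[u]%:P + t * ('X - u%:P) by rewrite -et addrC subrK.
  by rewrite expr2 {1}rE pr -mul_polyC; ring.
by rewrite linearD linearZ /= op // addr0 mulrC.
Qed.

(** Gauss quadrature for a polynomial that vanishes at all nodes but [u] and [v].
    The factors (u - a)^2 and (v - a)^2 are absorbed into [l] and [m]; they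
    are nonzero because the nodes lie to the left of [a]. *)
Lemma two_node_quadrature n p r u v g : p \is monic -> size p = n.+1 ->
  orthogonal_upto n p -> p = ('X - u%:P) * (('X - v%:P) * r) -> u != v ->
  (size g <= n)%N -> L (g * ('X - a%:P) ^+ 2 * r) = 0 ->
  exists l m, [/\ 0 < l, 0 < m &
    l * (g.[u] * r.[u]) + m * (g.[v] * r.[v]) = 0].
Proof.
move=> mp sp op pe uv szg Lg.
have p0 : p != 0 by exact: monic_neq0.
have r0 : r != 0.
  by apply: contraNneq p0 => r0; rewrite pe r0 !mulr0.
have szr : (size r).+2 = n.+1.
  rewrite -sp pe ![('X - _) * _]mulrC !size_Mmonic ?monicXsubC //.
    by rewrite !size_XsubC !addn2.
  by rewrite mulf_neq0 ?polyXsubC_eq0.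
have pe' : p = ('X - v%:P) * (('X - u%:P) * r) by rewrite pe; ring.
have szX z : size (('X - z%:P) * r) = n.
  rewrite mulrC size_Mmonic ?monicXsubC // size_XsubC addn2.
  by case: szr.
have X0 z : ('X - z%:P) * r != 0 by rewrite mulf_neq0 ?polyXsubC_eq0.
have wu := lagrange_weight pe op (eq_leq (szX v)) (X0 v).
have wv := lagrange_weight pe' op (eq_leq (szX u)) (X0 u).
have [_ rts] := orthogonal_all_roots mp sp op.
have ua : u < a by apply: rts; rewrite mem_rootsR // pe rootM root_XsubC eqxx.
have va : v < a by apply: rts; rewrite mem_rootsR // pe' rootM root_XsubC eqxx.
set G := g * ('X - a%:P) ^+ 2 in Lg.
have {}uv : v - u != 0 by rewrite subr_eq0 eq_sym.
(* [ell] is the linear interpolant of [G] at [u] and [v], scaled by [v - u]. *)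
pose ell := G.[v] *: ('X - u%:P) - G.[u] *: ('X - v%:P).
have [s es] : exists s, (v - u) *: G - ell = s * (('X - u%:P) * ('X - v%:P)).
  apply/dvdpP; rewrite Gauss_dvdp; last first.
    by rewrite coprimep_XsubC root_XsubC -subr_eq0.
  rewrite !dvdp_XsubCl !rootE /ell !(hornerD, hornerN, hornerZ, hornerX, hornerC).
  by apply/andP; split; apply/eqP; ring.
have szs : (size s <= n)%N.
  have [-> | s0] := eqVneq s 0; first by rewrite size_poly0.
  have : (size ((v - u) *: G - ell)%R <= n.+2)%N.
    rewrite (leq_trans (size_polyD _ _)) // geq_max size_polyN.
    rewrite (leq_trans (size_scale_leq _ _)); last first.
      rewrite (leq_trans (size_polyMleq _ _)) // size_exp_XsubC addn3.
      by rewrite !ltnS.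
    rewrite /ell (leq_trans (size_polyD _ _)) // geq_max size_polyN.
    by rewrite !(leq_trans (size_scale_leq _ _)) // size_XsubC.
  by rewrite es mulrA !size_Mmonic ?monicXsubC ?mulf_neq0 ?polyXsubC_eq0 //
    !size_XsubC !addn2.
have : L ((v - u) *: G * r) = 0 by rewrite -scalerAl linearZ /= Lg mulr0.
have -> : (v - u) *: G * r = p * s + G.[v] *: (('X - u%:P) * r) - G.[u] *: (('X - v%:P) * r).
  move/(canRL (subrK _)): es => ->.
  rewrite pe /ell -!mul_polyC; ring.
have LB q1 q2 : L (q1 - q2) = L q1 - L q2 by exact: linearB.
have LZ c q : L (c *: q) = c * L q by exact: linearZ.
rewrite LB linearD /= op // add0r !LZ => E.
have {}wu : 0 < L (('X - v%:P) * r) * (u - v) / r.[u].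
  have ru0 : r.[u] != 0 by apply/eqP => ru0; move: wu; rewrite hornerM ru0; lra.
  rewrite -(@pmulr_lgt0 _ (r.[u] ^+ 2)) ?exprn_even_gt0 //.
  by move: wu; rewrite hornerM hornerXsubC; congr (0 < _); field.
have {}wv : 0 < L (('X - u%:P) * r) * (v - u) / r.[v].
  have rv0 : r.[v] != 0 by apply/eqP => rv0; move: wv; rewrite hornerM rv0; lra.
  rewrite -(@pmulr_lgt0 _ (r.[v] ^+ 2)) ?exprn_even_gt0 //.
  by move: wv; rewrite hornerM hornerXsubC; congr (0 < _); field.
exists ((u - a) ^+ 2 * (L (('X - v%:P) * r) * (u - v) / r.[u])).
exists ((v - a) ^+ 2 * (L (('X - u%:P) * r) * (v - u) / r.[v])).
have sq_gt0 z : z < a -> 0 < (z - a) ^+ 2.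
  by move=> za; rewrite exprn_even_gt0 //= subr_eq0 lt_eqF.
split; [by rewrite mulr_gt0 ?sq_gt0 | by rewrite mulr_gt0 ?sq_gt0 |].
have ru0 : r.[u] != 0 by apply/eqP => ru0; move: wu; rewrite ru0 invr0; lra.
have rv0 : r.[v] != 0 by apply/eqP => rv0; move: wv; rewrite rv0 invr0; lra.
transitivity ((v - u) * (G.[v] * L (('X - u%:P) * r) - G.[u] * L (('X - v%:P) * r))).
  rewrite /G !(hornerM, horner_exp, hornerXsubC); field.
  by rewrite rv0 ru0.
by rewrite E mulr0.
Qed.

End positive_functionals.

(** * Interlacing with the polynomials for (x - a)^2 dmu *)

Section christoffel_zeros.
Variables (R : rcfType) (a : R) (L : {scalar {poly R}}).
Hypothesis Lpos : positive_left a L.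
Variables (n : nat) (p g : {poly R}).
Hypotheses (mp : p \is monic) (sp : size p = n.+1)
  (op : orthogonal_upto L n p).
Hypotheses (mg : g \is monic) (sg : size g = n)
  (og : forall r : {poly R}, (size r < n)%N -> L (g * ('X - a%:P) ^+ 2 * r) = 0).

Let x k := (rootsR p)`_k.

Let two_nodes (i j : 'I_n) : i != j ->
  exists2 r, p = ('X - (x i)%:P) * (('X - (x j)%:P) * r) &
    r = \prod_(k | (k != i) && (k != j)) ('X - (x k)%:P) /\
    exists l m, [/\ 0 < l, 0 < m &
    l * (g.[x i] * r.[x i]) + m * (g.[x j] * r.[x j]) = 0].
Proof.
move=> ij; have [sr _] := orthogonal_all_roots Lpos mp sp op.
pose r := \prod_(k < n | (k != i) && (k != j)) ('X - (x k)%:P).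
have pe : p = ('X - (x i)%:P) * (('X - (x j)%:P) * r).
  rewrite [LHS](monic_prod_rootsR mp sp sr) (bigD1 i) //=.
  by rewrite (bigD1 j) //= eq_sym.
have xij : x i != x j.
  by rewrite /x nth_uniq ?sr // uniq_rootsR.
exists r => //; split=> //.
apply: (two_node_quadrature Lpos mp sp op pe xij); first by rewrite sg.
apply: og; have r0 : r != 0 by exact/monic_neq0/monic_prod_XsubC.
move: sp; rewrite pe ![('X - _) * _]mulrC !size_Mmonic ?monicXsubC //.
  by rewrite !size_XsubC !addn2 => -[<-].
by rewrite mulf_neq0 ?polyXsubC_eq0.
Qed.

(** The two-node identity spreads a zero of [g] from one node to every other one,
    and [g] has degree only [n] - 1. *)
Lemma christoffel_neq0 (i : 'I_n) : g.[x i] != 0.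
Proof.
apply/eqP => gi.
have [sr _] := orthogonal_all_roots Lpos mp sp op.
have : (size (rootsR p) < size g)%N.
  apply: max_poly_roots (uniq_rootsR p); first exact: monic_neq0.
  apply/(all_nthP 0) => k; rewrite sr => kn; pose j := Ordinal kn.
  have [ij|ij] := eqVneq i j; first by apply/rootP; move: gi; rewrite ij.
  have [r pe [re [l [m [l0 m0]]]]] := two_nodes ij.
  rewrite gi mul0r mulr0 add0r => /eqP; rewrite !mulf_eq0 gt_eqF //=.
  case/orP=> //; rewrite -rootE re => rj; exfalso.
  move: rj; rewrite rootE horner_prod prodf_seq_eq0 => /hasP[h _ /andP[/andP[_ hj]]].
  rewrite hornerXsubC subr_eq0 /x nth_uniq ?sr ?uniq_rootsR // eq_sym.
  by apply/negP; move: hj; rewrite -val_eqE.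
by rewrite sr sg ltnn.
Qed.

(** The cofactor [r] has the same sign at two consecutive nodes, so the two-node
    identity forces opposite signs on [g]. *)
Lemma christoffel_alternates k : (k.+1 < n)%N -> g.[x k] * g.[x k.+1] < 0.
Proof.
move=> kn; have [sr _] := orthogonal_all_roots Lpos mp sp op.
pose i := Ordinal (ltnW kn); pose j := Ordinal kn.
have ij : i != j by rewrite -val_eqE /= ltn_eqF.
have [r _ [re [l [m [l0 m0 E]]]]] := two_nodes ij.
have rr : 0 < r.[x i] * r.[x j].
  rewrite re !horner_prod -big_split /=; apply: prodr_gt0 => h /andP[hi hj].
  rewrite !hornerXsubC.
  have [hk|hk] := ltnP h k.
    by rewrite mulr_gt0 // subr_gt0 rootsR_increasing ?sr // ltnW.
  have {}hk : (k.+1 < h)%N.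
    by rewrite ltn_neqAle eq_sym hj /= ltn_neqAle eq_sym hi.
  by rewrite nmulr_rgt0 subr_lt0 rootsR_increasing ?sr // ltnW.
have gi := christoffel_neq0 i; have gj := christoffel_neq0 j.
rewrite -[x k]/(x i) -[x k.+1]/(x j).
rewrite lt_neqAle mulf_neq0 //= leNgt; apply/negP => gg.
have /eqP : (l * (g.[x i] * r.[x i]) + m * (g.[x j] * r.[x j])) ^+ 2 = 0.
  by rewrite E expr0n.
rewrite gt_eqF // sqrrD.
have h : 0 < l * (g.[x i] * r.[x i]) * (m * (g.[x j] * r.[x j])).
  rewrite (_ : _ * _ = (l * m) * (g.[x i] * g.[x j]) * (r.[x i] * r.[x j])).
    exact: mulr_gt0 (mulr_gt0 (mulr_gt0 l0 m0) gg) rr.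
  by ring.
by rewrite ltr_pwDl ?sqr_ge0 // ltr_wpDl ?sqr_ge0 // mulrn_wgt0.
Qed.

Lemma christoffel_interlacing : size (rootsR g) = n.-1 /\
  forall k, (k.+1 < n)%N -> x k < (rootsR g)`_k < x k.+1.
Proof.
have [sr _] := orthogonal_all_roots Lpos mp sp op.
have n0 : (0 < n)%N by rewrite -sg size_poly_gt0 monic_neq0.
have sg' : size g = n.-1.+1 by rewrite prednK.
have [k kn|k kn|h1 h2] := @rootsR_in_intervals _ g n.-1 x (fun k => x k.+1) sg'.
- have {}kn : (k.+1 < n)%N by rewrite -ltn_predRL.
  by rewrite christoffel_alternates // rootsR_increasing ?sr.
- exact: lexx.
by split=> // k kn; apply: h2; rewrite ltn_predRL.
Qed.

End christoffel_zeros.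

(** * The pencil spanned by two interlacing polynomials *)

Section pencil.
Variables (R : rcfType) (n : nat) (x y : nat -> R).
Hypothesis xy : forall k, (k < n)%N -> x k < y k.
Hypothesis yx : forall k, (k.+1 < n)%N -> y k < x k.+1.

Definition nodal (z : nat -> R) : {poly R} := \prod_(i < n) ('X - (z i)%:P).

Definition pencil c : {poly R} := nodal x + c *: nodal y.

Lemma interlace_lt i j : (i < j)%N -> (j < n)%N -> y i < x j.
Proof.
elim: j => // j IH; rewrite ltnS leq_eqVlt => /predU1P[->|ij] jn; first exact: yx.
by apply: lt_trans (IH ij (ltnW jn)) (lt_trans (xy (ltnW jn)) (yx jn)).
Qed.

Lemma nodalE z w : (nodal z).[w] = \prod_(i < n) (w - z i).
Proof. by rewrite horner_prod; apply: eq_bigr => i _; rewrite hornerXsubC. Qed.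

Lemma monic_nodal z : nodal z \is monic.
Proof. exact: monic_prod_XsubC. Qed.

Lemma size_nodal z : size (nodal z) = n.+1.
Proof. by rewrite size_prod_XsubC /index_enum -enumT size_enum_ord. Qed.

Lemma size_pencil c : 0 < c -> size (pencil c) = n.+1.
Proof.
move=> c0; apply/eqP; rewrite eqn_leq; apply/andP; split.
  rewrite (leq_trans (size_polyD _ _)) // geq_max size_nodal leqnn.
  by rewrite (leq_trans (size_scale_leq _ _)) // size_nodal.
rewrite ltnNge; apply/negP => /leq_sizeP/(_ _ (leqnn n))/eqP; apply/negP.
rewrite coefD coefZ.
have cn z : (nodal z)`_n = 1.
  by have := monicP (monic_nodal z); rewrite lead_coefE size_nodal.
by rewrite !cn mulr1 gt_eqF // addr_gt0.
Qed.

(** The intervals [x i, y i] are pairwise disjoint, so both factors tell on which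
    side of the [i]-th interval the [k]-th one lies. *)
Let other_factors k w (i : 'I_n) : (k < n)%N -> x k <= w <= y k ->
  i != k :> nat -> 0 < (w - y i) * (y k - x i).
Proof.
move=> kn /andP[w1 w2]; rewrite neq_ltn => /orP[ik|ki].
  have h := interlace_lt ik kn; have h' := xy (ltn_ord i); have h2 := xy kn.
  by rewrite mulr_gt0 // subr_gt0; lra.
have h := interlace_lt ki (ltn_ord i); have h' := xy (ltn_ord i).
by rewrite nmulr_rgt0 subr_lt0; lra.
Qed.

(** In the product of the two values, the factors of index different from [k] pair
    into positive numbers and those of index [k] have opposite signs. *)
Lemma nodal_sign k w : (k < n)%N -> x k <= w < y k ->
  (nodal y).[w] * (nodal x).[y k] < 0.
Proof.
move=> kn /andP[w1 w2]; rewrite !nodalE -big_split /= (bigD1 (Ordinal kn)) //=.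
rewrite pmulr_llt0; last first.
  by apply: prodr_gt0 => i ik; apply: other_factors; rewrite // w1 ltW.
by rewrite pmulr_llt0 ?subr_gt0 ?subr_lt0 // xy.
Qed.

Lemma horner_pencil c w : (pencil c).[w] = (nodal x).[w] + c * (nodal y).[w].
Proof. by rewrite hornerD hornerZ. Qed.

Lemma nodal_root z k : (k < n)%N -> (nodal z).[z k] = 0.
Proof. by move=> kn; rewrite nodalE (bigD1 (Ordinal kn)) //= subrr mul0r. Qed.

Lemma pencil_right_end c k : (k < n)%N -> (pencil c).[y k] = (nodal x).[y k].
Proof. by move=> kn; rewrite horner_pencil nodal_root // mulr0 addr0. Qed.

Lemma pencil_zeros c : 0 < c -> size (rootsR (pencil c)) = n /\
  forall k, (k < n)%N -> x k < (rootsR (pencil c))`_k < y k.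
Proof.
move=> c0; apply: rootsR_in_intervals; first exact: size_pencil.
- move=> k kn; split; first exact: xy.
  rewrite pencil_right_end // horner_pencil nodal_root // add0r -mulrA.
  by rewrite pmulr_rlt0 // nodal_sign // lexx xy.
- by move=> k kn; rewrite ltW ?yx.
Qed.

Lemma pencil_zero_root c k : 0 < c -> (k < n)%N ->
  (pencil c).[(rootsR (pencil c))`_k] = 0.
Proof.
move=> c0 kn; apply/rootP; rewrite -mem_rootsR ?mem_nth //.
  by have [-> _] := pencil_zeros c0.
by rewrite -size_poly_eq0 size_pencil.
Qed.

(** The pencil has the sign of P(y_k) at the right end y_k, so it vanishes between
    [w] and y_k, and only its [k]-th zero can be there. *)
Lemma pencil_zero_gt c k w : 0 < c -> (k < n)%N -> x k <= w < y k ->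
  (pencil c).[w] * (nodal x).[y k] < 0 -> w < (rootsR (pencil c))`_k.
Proof.
move=> c0 kn /andP[w1 w2] sgn.
have [sz zP] := pencil_zeros c0.
have [|z] := @poly_ivtoo _ (pencil c) w (y k) (ltW w2).
  by rewrite pencil_right_end.
rewrite in_itv /= => /andP[wz zy].
rewrite -mem_rootsR; last by rewrite -size_poly_eq0 size_pencil.
move=> /(nthP 0)[j]; rewrite sz => jn zE; rewrite -zE in wz zy.
have /andP[h1 h2] := zP j jn.
have [jk|kj|<- //] := ltngtP j k.
- have := interlace_lt jk kn; lra.
- have := interlace_lt kj jn; lra.
Qed.

(** At a zero z of P + c Q the pencil for c' takes the value (c' - c) Q(z). *)
Lemma pencil_zero_increasing c c' k : 0 < c -> c < c' -> (k < n)%N ->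
  (rootsR (pencil c))`_k < (rootsR (pencil c'))`_k.
Proof.
move=> c0 cc' kn; have [_ /(_ k kn)/andP[h1 h2]] := pencil_zeros c0.
apply: pencil_zero_gt; rewrite ?(ltW h1) //; first exact: lt_trans cc'.
set z := (rootsR (pencil c))`_k in h1 h2 *.
have -> : (pencil c').[z] = (c' - c) * (nodal y).[z].
  have := pencil_zero_root c0 kn; rewrite -/z !horner_pencil => E.
  by rewrite mulrBl -[LHS]subr0 -E; ring.
by rewrite -mulrA pmulr_rlt0 ?subr_gt0 // nodal_sign // h2 ltW.
Qed.

(** For c large the sign of P + c Q at [w] is that of Q. *)
Lemma pencil_zero_eventually_gt k w : (k < n)%N -> x k <= w < y k ->
  exists2 c0, 0 < c0 & forall c, c0 < c -> w < (rootsR (pencil c))`_k.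
Proof.
move=> kn wk; have s := nodal_sign kn wk.
set q := _ * _ in s; pose m := (nodal x).[w] * (nodal x).[y k].
(* Beyond [m / - q] the multiple of [q] outweighs [m]. *)
exists (Num.max 1 (m / - q)); first by rewrite lt_max ltr01.
move=> c; rewrite gt_max => /andP[c1 cm].
have c0 : 0 < c := lt_trans ltr01 c1.
apply: pencil_zero_gt => //; rewrite horner_pencil mulrDl -/m -mulrA -/q.
by move: cm; rewrite ltr_pdivrMr ?oppr_gt0 //; lra.
Qed.

End pencil.

(** * Adding a point mass *)

Section orthogonal_sequences.
Variable R : rcfType.
Implicit Types (q : {poly R}).

Lemma monic_basis (P : nat -> {poly R}) : (forall j, size (P j) = j.+1) ->
  (forall j, P j \is monic) -> forall n q, (size q <= n)%N ->
  exists c : nat -> R, q = \sum_(j < n) c j *: P j.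
Proof.
move=> sP mP; elim=> [|n IH] q.
  by rewrite leqn0 size_poly_eq0 => /eqP ->; exists (fun=> 0); rewrite big_ord0.
move=> szq; have [|c ec] := IH (q - q`_n *: P n).
  apply/leq_sizeP => j; rewrite leq_eqVlt coefB coefZ => /predU1P[<-|nj].
    have := monicP (mP n); rewrite lead_coefE sP /= => ->.
    by rewrite mulr1 subrr.
  by rewrite [q`_j]nth_default ?(leq_trans szq) // [(P n)`_j]nth_default ?sP // mulr0 subrr.
exists (fun j => if j == n then q`_n else c j).
rewrite big_ord_recr /= eqxx.
under eq_bigr => j _ do rewrite ltn_eqF //.
by rewrite -ec subrK.
Qed.

(** [Phi] is a bare function because it is also taken to be
    q |-> L ((X - a)^2 q) and q |-> L q + N q(a), which are not declared as
    linear maps. *)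
Lemma OPS_orthogonal (Phi : {poly R} -> R) (P : nat -> {poly R}) :
  (forall c p q, Phi (c *: p + q) = c * Phi p + Phi q) ->
  (forall j, size (P j) = j.+1) -> (forall j, P j \is monic) ->
  (forall i j, i <> j -> Phi (P i * P j) = 0) ->
  forall n q, (size q <= n)%N -> Phi (P n * q) = 0.
Proof.
move=> lin sP mP oP n q /(monic_basis sP mP)[c ->].
have Phi0 : Phi 0 = 0.
  by have := lin 1 0 0; rewrite scaler0 addr0 mul1r => /eqP; rewrite -subr_eq subrr => /eqP.
have {lin} : forall m, (m <= n)%N -> Phi (P n * \sum_(j < m) c j *: P j) = 0.
  elim=> [|m IH] mn; first by rewrite big_ord0 mulr0.
  rewrite big_ord_recr /= mulrDr addrC -scalerAr lin IH ?(ltnW mn) // addr0 oP ?mulr0 //.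
  by move=> nm; move: mn; rewrite nm ltnn.
by apply.
Qed.

End orthogonal_sequences.

Section mass_point.
Variables (R : rcfType) (a : R) (L : {scalar {poly R}}).
Hypothesis Lpos : positive_left a L.
Variable P : nat -> {poly R}.
Hypotheses (sP : forall j, size (P j) = j.+1) (mP : forall j, P j \is monic)
  (oP : forall i j, i <> j -> L (P i * P j) = 0).
Implicit Types (q r : {poly R}).

Let oPn n : orthogonal_upto L n (P n).
Proof. by apply: OPS_orthogonal => // c p q; rewrite linearD linearZ. Qed.

(** The Christoffel-Darboux kernel K(X, a) of index [n] - 1, as a polynomial. *)
Definition kernel_at n : {poly R} :=
  \sum_(j < n) ((P j).[a] / L (P j * P j)) *: P j.

Let norm_gt0 j : 0 < L (P j * P j).
Proof. by rewrite -expr2 (functional_sqr_gt0 Lpos) ?monic_neq0. Qed.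

Lemma size_kernel_at n : (size (kernel_at n) <= n)%N.
Proof.
apply: (leq_trans (size_sum _ _ _)); apply/bigmax_leqP => j _.
by rewrite (leq_trans (size_scale_leq _ _)) // sP.
Qed.

Lemma kernel_reproducing n q : (size q <= n)%N -> L (q * kernel_at n) = q.[a].
Proof.
move=> /(monic_basis sP mP)[c ->].
rewrite mulr_suml linear_sum horner_sum /=; apply: eq_bigr => i _.
rewrite -scalerAl linearZ hornerZ /=; congr (_ * _).
rewrite /kernel_at mulr_sumr linear_sum (bigD1 i) //= big1 ?addr0.
  by rewrite -scalerAr linearZ /= divfK // gt_eqF.
move=> j ji; rewrite -scalerAr linearZ /= [L (P i * _)]oP ?mulr0 // => ij.
by move: ji; rewrite -val_eqE /= ij eqxx.
Qed.

Lemma kernel_at_gt0 n : (0 < n)%N -> 0 < (kernel_at n).[a].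
Proof.
case: n => // n _; rewrite horner_sum big_ord_recl /= ltr_pwDl //.
  have -> : P 0%N = 1.
    have /eqP/size_poly1P[c _ ec] := sP 0; have := monicP (mP 0).
    by rewrite ec lead_coefC => ->.
  by rewrite hornerZ hornerC mulr1 div1r invr_gt0 mulr1 Lpos ?oner_neq0 // => x _; rewrite hornerC.
apply: sumr_ge0 => j _; rewrite hornerZ mulrAC -expr2.
by rewrite divr_ge0 ?sqr_ge0 // ltW.
Qed.

Variables (n : nat) (g : {poly R}).
Hypothesis n_gt0 : (0 < n)%N.
Hypotheses (mg : g \is monic) (sg : size g = n)
  (og : forall r : {poly R}, (size r < n)%N -> L (g * ('X - a%:P) ^+ 2 * r) = 0).

Let Q := ('X - a%:P) * g.
Let B := (kernel_at n).[a].

Let mQ : Q \is monic. Proof. by rewrite monicMl ?monicXsubC. Qed.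

Let sQ : size Q = n.+1.
Proof.
by rewrite /Q mulrC size_Mmonic ?monicXsubC ?monic_neq0 // size_XsubC sg addn2.
Qed.

Let sQP : (size (Q - P n)%R <= n)%N.
Proof.
have := monicP mQ; have := monicP (mP n); rewrite !lead_coefE sQ sP /= => h1 h2.
apply/leq_sizeP => j; rewrite leq_eqVlt coefB => /predU1P[<-|nj].
  by rewrite h1 h2 subrr.
by rewrite !nth_default ?subrr // ?sQ ?sP.
Qed.

(** Q = (X - a) g is orthogonal to r - r(a), a multiple of X - a of degree < n. *)
Lemma christoffel_functional r : (size r <= n)%N -> L (Q * r) = r.[a] * L Q.
Proof.
move=> szr; have /factor_theorem[t et] : root (r - r.[a]%:P) a.
  by rewrite rootE !hornerE subrr.
have szt : (size t < n)%N.
  have [-> | t0] := eqVneq t 0; first by rewrite size_poly0.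
  have : (size (r - r.[a]%:P)%R <= n)%N.
    rewrite (leq_trans (size_polyD _ _)) // geq_max szr size_polyN.
    by rewrite (leq_trans (size_polyC_leq1 _)).
  by rewrite et size_Mmonic ?monicXsubC // size_XsubC addn2.
have -> : Q * r = r.[a] *: Q + g * ('X - a%:P) ^+ 2 * t.
  have rE : r = r.[a]%:P + t * ('X - a%:P) by rewrite -et addrC subrK.
  by rewrite {1}rE /Q -mul_polyC; ring.
by rewrite linearD linearZ /= og // addr0.
Qed.

(** Apply the previous identity to the kernel, and evaluate L(Q K) by the
    reproducing property: Q - P has degree < n and P is orthogonal to K. *)
Lemma christoffel_integral : B * L Q = - (P n).[a].
Proof.
rewrite -christoffel_functional ?size_kernel_at //.
have -> : Q * kernel_at n = (Q - P n) * kernel_at n + P n * kernel_at n by ring.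
rewrite linearD /= (kernel_reproducing sQP) oPn ?size_kernel_at // addr0.
by rewrite /Q hornerD hornerN hornerM hornerXsubC subrr mul0r sub0r.
Qed.

(** Both sides have leading coefficient 1 + N B and satisfy the same orthogonality
    relations for q |-> L(q) + N q(a): for the right-hand side, these amount to
    B L(Q) = - P(a).  So their difference has degree < n and norm zero. *)
Lemma mass_point_pencil N W : 0 < N -> W \is monic -> size W = n.+1 ->
  (forall r, (size r <= n)%N -> L (W * r) + N * (W * r).[a] = 0) ->
  (1 + N * B) *: W = P n + (N * B) *: Q.
Proof.
move=> N0 mW sW oW; apply/eqP; rewrite -subr_eq0; apply/eqP.
set D := _ - _.
have szD : (size D <= n)%N.
  have := monicP mQ; have := monicP (mP n); have := monicP mW.
  rewrite !lead_coefE sQ sP sW /= => h1 h2 h3.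
  apply/leq_sizeP => j; rewrite leq_eqVlt coefB coefD !coefZ => /predU1P[<-|nj].
    by rewrite h1 h2 h3; ring.
  by rewrite !nth_default ?sQ ?sP ?sW //; ring.
have DE : D * D = (1 + N * B) *: (W * D) - (P n * D + (N * B) *: (Q * D)).
  by rewrite {1}/D -!mul_polyC; ring.
have Da : D.[a] = (1 + N * B) * W.[a] - (P n).[a].
  rewrite /D hornerD hornerN hornerD !hornerZ /Q hornerM hornerXsubC subrr.
  by ring.
have LD : L (D * D) + N * D.[a] ^+ 2 = 0.
  rewrite DE linearB linearZ linearD linearZ /= oPn // christoffel_functional //.
  have /eqP := oW D szD; rewrite addr_eq0 hornerM => /eqP ->.
  have -> : N * D.[a] ^+ 2 = N * D.[a] * D.[a] by ring.
  rewrite {3}Da; have E := christoffel_integral.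
  transitivity (- (N * D.[a] * (B * L Q + (P n).[a]))); first by ring.
  by rewrite E addNr mulr0 oppr0.
apply: contra_eq LD => D0; rewrite gt_eqF // ltr_pwDl //.
  by rewrite -expr2 (functional_sqr_gt0 Lpos).
by rewrite mulr_ge0 ?sqr_ge0 // ltW.
Qed.

End mass_point.

(** * Asymptotics of the zeros of the pencil *)

Section pencil_asymptotics.
Variables (R : realType) (n : nat) (x y : nat -> R) (B : R).
Hypothesis xy : forall k, (k < n)%N -> x k < y k.
Hypothesis yx : forall k, (k.+1 < n)%N -> y k < x k.+1.
Hypothesis B0 : 0 < B.

Let z k (N : R) := (rootsR (pencil n x y (N * B)))`_k.

Lemma pencil_zero_cvg k : (k < n)%N -> z k N @[N --> +oo] --> y k.
Proof.
move=> kn; apply/cvgrPdist_lt => e e0; have xyk := xy kn.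
have [|c0 c00 hc] := @pencil_zero_eventually_gt _ n x y xy yx k
    (Num.max (x k) (y k - e)) kn.
  by rewrite le_max lexx /= gt_max xyk ltrBlDr ltrDl.
near=> N.
have NB : c0 < N * B.
  by rewrite -ltr_pdivrMr //; near: N; apply: nbhs_pinfty_gt; rewrite num_real.
have [_ /(_ k kn)/andP[_ zy]] := pencil_zeros xy yx (lt_trans c00 NB).
have := hc _ NB; rewrite gt_max => /andP[_ h].
by rewrite gtr0_norm ?subr_gt0 // ltrBlDr addrC -ltrBlDr.
Unshelve. all: by end_near. Qed.

(** With Q = (X - y_k) T the equation of the zero z reads
    N (y_k - z) = P(z) / (B T(z)), and T(y_k) = Q'(y_k). *)
Lemma pencil_zero_rate k : (k < n)%N ->
  N * (y k - z k N) @[N --> +oo] -->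
    (nodal n x).[y k] / (B * (nodal n y)^`().[y k]).
Proof.
move=> kn; pose T := \prod_(i < n | i != Ordinal kn) ('X - (y i)%:P).
have QE : nodal n y = ('X - (y k)%:P) * T by rewrite /nodal (bigD1 (Ordinal kn)).
have dQ : (nodal n y)^`().[y k] = T.[y k].
  by rewrite QE derivM derivXsubC mul1r !(hornerD, hornerM, hornerN, hornerX, hornerC) subrr mul0r addr0.
have Tz w : x k <= w <= y k -> T.[w] != 0.
  move=> /andP[w1 w2]; have [wy|wy] := ltP w (y k).
    have := @nodal_sign _ n x y xy yx k w kn; rewrite w1 wy QE hornerM => /(_ isT).
    by apply: contraTneq => ->; rewrite mulr0 mul0r ltxx.
  have -> : w = y k by apply/eqP; rewrite eq_le w2.
  rewrite horner_prod; apply/prodf_neq0 => i ik; rewrite hornerXsubC subr_eq0.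
  have [h|h|h] := ltngtP (i : nat) k.
  - have := interlace_lt xy yx h kn; have := xy kn; lra.
  - have := interlace_lt xy yx h (ltn_ord i); have := xy (ltn_ord i); lra.
  - by move: ik; rewrite -val_eqE /= h eqxx.
have Ty : T.[y k] != 0 by rewrite Tz // lexx ltW ?xy.
have : (nodal n x).[z k N] / (B * T.[z k N]) @[N --> +oo] -->
    (nodal n x).[y k] / (B * T.[y k]).
  have ch q : q.[z k N] @[N --> +oo] --> q.[y k].
    exact: (continuous_cvg _ (@continuous_horner _ q _) (pencil_zero_cvg kn)).
  apply: cvgM (ch _) _; apply: cvgV; first by rewrite mulf_neq0 // gt_eqF.
  exact: cvgM (cvg_cst _) (ch _).
rewrite dQ; apply: cvg_trans; apply: near_eq_cvg; near=> N.
have N0 : 0 < N by near: N; apply: nbhs_pinfty_gt; rewrite num_real.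
have NB : 0 < N * B by exact: mulr_gt0.
have [_ /(_ k kn)/andP[xz zy]] := pencil_zeros xy yx NB.
have Tz0 : T.[z k N] != 0 by rewrite Tz // !ltW.
have := pencil_zero_root xy yx NB kn; rewrite -/(z k N) horner_pencil QE hornerM hornerXsubC.
move=> /eqP; rewrite addr_eq0 => /eqP ->.
by field; rewrite Tz0 gt_eqF.
Unshelve. all: by end_near. Qed.

End pencil_asymptotics.

(** * Integration against densities and point masses *)

Section density.
Local Open Scope ereal_scope.
Context d (T : measurableType d) (R : realType).
Variables (mu nu : {measure set T -> \bar R}) (w : T -> R).
Hypotheses (mw : measurable_fun setT w) (w0 : forall x, (0 <= w x)%R).
Hypothesis nuE : forall A, measurable A -> nu A = \int[mu]_(x in A) (w x)%:E.

Import HBNNSimple.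

Let mwE : measurable_fun setT (EFin \o w).
Proof. exact/measurable_EFinP. Qed.

Let integral_density_indic A : measurable A ->
  \int[nu]_x (\1_A x)%:E = \int[mu]_x ((\1_A x)%:E * (w x)%:E).
Proof.
move=> mA; rewrite integral_indic // setIT nuE // integral_mkcond.
apply: eq_integral => x _; rewrite patchE indicE.
by case: ifP; rewrite ?mul1e ?mul0e.
Qed.

Let integral_density_nnsfun (h : {nnsfun T >-> R}) :
  \int[nu]_x (h x)%:E = \int[mu]_x ((h x)%:E * (w x)%:E).
Proof.
have mi r : measurable_fun setT (fun x => (r * \1_(h @^-1` [set r]) x)%:E).
  by apply/measurable_EFinP; do 2 apply/measurableT_comp => //.
have hE x : (h x)%:E = \sum_(r \in range h) (r * \1_(h @^-1` [set r]) x)%:E.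
  by rewrite fimfunE -fsumEFin.
transitivity (\int[mu]_x (\sum_(r \in range h)
    ((r * \1_(h @^-1` [set r]) x)%:E * (w x)%:E))); last first.
  apply: eq_integral => x _; rewrite hE ge0_mule_fsuml // => r.
  exact: nnfun_muleindic_ge0.
under eq_integral do rewrite hE.
rewrite !ge0_integral_fsum //; last 3 first.
- by move=> r; exact: emeasurable_funM.
- by move=> r x _; rewrite mule_ge0 ?lee_fin // -lee_fin nnfun_muleindic_ge0.
- by move=> r x _; rewrite nnfun_muleindic_ge0.
apply: eq_fsbigr => r _.
rewrite integralZl_indic_nnsfun // integral_density_indic //.
have [r0|r0] := leP 0%R r.
  rewrite -ge0_integralZl //.
  - by apply: eq_integral => x _; rewrite EFinM muleA.
  - by apply: emeasurable_funM => //; exact/measurable_EFinP.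
  - by move=> x _; rewrite mule_ge0 ?lee_fin.
rewrite preimage_nnfun0 //; under [RHS]eq_integral do rewrite indic0 mulr0 mul0e.
by under eq_integral do rewrite indic0 mul0e; rewrite !integral0 mule0.
Qed.

(** The identity holds for indicators by hypothesis, then for simple functions by
    linearity, then in general by monotone convergence. *)
Lemma ge0_integral_density (f : T -> \bar R) : measurable_fun setT f ->
  (forall x, 0 <= f x) -> \int[nu]_x f x = \int[mu]_x (f x * (w x)%:E).
Proof.
move=> mf f0; pose f_ := nnsfun_approx measurableT mf.
have nd x : {homo (fun n => (f_ n x)%:E) : a b / (a <= b)%N >-> a <= b}.
  by move=> a b ab; rewrite lee_fin; exact/lefP/nd_nnsfun_approx.
have lim_f x : limn (fun n => (f_ n x)%:E) = f x.
  by apply/cvg_lim => //; exact: cvg_nnsfun_approx.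
transitivity (limn (fun n => \int[nu]_x (f_ n x)%:E)).
  rewrite -monotone_convergence //=.
  - by apply: eq_integral => x _; rewrite lim_f.
  - by move=> n; exact/measurable_EFinP.
  - by move=> n x _; rewrite lee_fin.
transitivity (limn (fun n => \int[mu]_x ((f_ n x)%:E * (w x)%:E))).
  by congr (limn _); apply/funext => n; rewrite integral_density_nnsfun.
rewrite -monotone_convergence //=.
- apply: eq_integral => x _; apply/cvg_lim => //.
  by apply: cvgeZr => //; exact: cvg_nnsfun_approx.
- by move=> n; apply: emeasurable_funM => //; exact/measurable_EFinP.
- by move=> n x _; rewrite mule_ge0 // lee_fin.
- by move=> x _ a b ab; rewrite lee_pmul ?lee_fin //; exact: nd.
Qed.

Lemma integral_density (f : T -> \bar R) : measurable_fun setT f ->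
  \int[nu]_x f x = \int[mu]_x (f x * (w x)%:E).
Proof.
move=> mf; rewrite integralE [RHS]integralE.
rewrite !ge0_integral_density //; last 2 first.
- exact: measurable_funeneg.
- exact: measurable_funepos.
have wf x : (w x)%:E \is a fin_num by [].
congr (_ - _); apply: eq_integral => x _.
- by rewrite !funeposE maxe_pMl ?lee_fin // mul0e.
- by rewrite !funenegE maxe_pMl ?lee_fin // mul0e mulNe.
Qed.

End density.

Section point_mass.
Local Open Scope ereal_scope.
Context d (T : measurableType d) (R : realType).
Variables (mu : {measure set T -> \bar R}) (a : T) (N : {nonneg R}).

Lemma integral_mscale_dirac (f : T -> R) : measurable_fun setT f ->
  \int[mscale N \d_a]_x (f x)%:E = (N%:num * f a)%:E.
Proof.
move=> mf; have mfE : measurable_fun setT (EFin \o f) by exact/measurable_EFinP.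
rewrite integralE !ge0_integral_mscale //; last 2 first.
- exact: measurable_funeneg.
- exact: measurable_funepos.
rewrite !integral_dirac ?diracT ?mul1e //; last 2 first.
- exact: measurable_funeneg.
- exact: measurable_funepos.
rewrite funeposE funenegE -!EFinN -!EFin_max -!EFinM -EFinB; congr EFin.
rewrite -mulrBr; congr (_ * _)%R.
have [h|/ltW h] := leP (f a) 0%R.
  by rewrite max_l ?oppr_ge0 // sub0r opprK.
by rewrite max_r ?oppr_le0 // subr0.
Qed.

Lemma integrable_mscale_dirac (f : T -> R) : measurable_fun setT f ->
  (mscale N \d_a).-integrable setT (EFin \o f).
Proof.
move=> mf; apply/integrableP; split; first exact/measurable_EFinP.
under eq_integral do rewrite abse_EFin.
by rewrite integral_mscale_dirac ?ltry //; exact: measurableT_comp.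
Qed.

End point_mass.

(** * Integration of polynomials as a positive functional *)

Section moment_functional.
Variables (R : realType) (mu : {measure set R -> \bar R}).
Implicit Types (p q : {poly R}) (a : R).

Definition moment q : R := \int[mu]_x q.[x].

Hypothesis hmom : finite_moments mu.

Lemma integrable_poly q : mu.-integrable setT (EFin \o horner q).
Proof.
have -> : EFin \o horner q = fun x => (\sum_(i < size q) (q`_i)%:E * (x ^+ i)%:E)%E.
  by apply/funext => x /=; rewrite horner_coef -sumEFin.
by apply: integrable_sum => // i _; apply: integrableZl => //; exact: hmom.
Qed.

Lemma moment_linear : scalar moment.
Proof.
move=> c p q; rewrite /moment.
under eq_Rintegral do rewrite hornerD hornerZ.
rewrite RintegralD //; last exact: integrable_poly.
  by rewrite RintegralZl //; exact: integrable_poly.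
have -> : (EFin \o (fun x => c * p.[x])) = EFin \o horner (c *: p).
  by apply/funext => x /=; rewrite hornerZ.
exact: integrable_poly.
Qed.

Lemma inner_moment p q : inner mu p q = moment (p * q).
Proof. by apply: eq_Rintegral => x _; rewrite hornerM. Qed.

Lemma inner_add_mass a (N : {nonneg R}) p q :
  inner (add_mass mu a N) p q = moment (p * q) + N%:num * (p * q).[a].
Proof.
rewrite -inner_moment /inner /Rintegral.
have -> : (fun x => (p.[x] * q.[x])%:E) = EFin \o horner (p * q).
  by apply/funext => x /=; rewrite hornerM.
rewrite /add_mass integral_measure_add //=.
- have fin : (\int[mu]_x ((p * q).[x])%:E)%E \is a fin_num.
    exact: integrable_fin_num (integrable_poly _).
  by rewrite integral_mscale_dirac; [rewrite fineD | exact: measurable_poly].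
- exact: integrable_poly.
- by apply: integrable_mscale_dirac; exact: measurable_poly.
Qed.

Lemma inner_sq_weight a p q :
  inner (sq_weight mu a) p q = moment (p * q * ('X - a%:P) ^+ 2).
Proof.
rewrite /inner /moment /Rintegral; congr fine.
have mw : measurable_fun setT (fun x : R => (x - a) ^+ 2).
  by apply: measurable_funX; exact: measurable_funB.
have w0 x : 0 <= (x - a) ^+ 2 by exact: sqr_ge0.
have mpq : measurable_fun setT (fun x => (p.[x] * q.[x])%:E).
  by apply/measurable_EFinP; apply: measurable_funM; exact: measurable_poly.
have nuE A : measurable A ->
    sq_weight mu a A = (\int[mu]_(x in A) ((x - a) ^+ 2)%:E)%E by [].
rewrite (@integral_density _ _ _ mu (sq_weight mu a) _ mw w0 nuE _ mpq).
apply: eq_integral => x _.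
have E : (p * q * ('X - a%:P) ^+ 2).[x] = p.[x] * q.[x] * (x - a) ^+ 2.
  by rewrite 2!hornerM horner_exp hornerXsubC.
by rewrite E [RHS]EFinM.
Qed.

(** The real line has a countable base: a point off the support lies in a null
    open interval with rational endpoints, and there are countably many of
    them. *)
Lemma negligible_setC_support : mu.-negligible (~` measure_support mu).
Proof.
pose I (u : rat * rat) : set R := `]ratr u.1, ratr u.2[%classic.
pose F n : set R := if unpickle n is Some u then
  if mu (I u) == 0%E then I u else set0 else set0.
apply: (@negligibleS _ _ _ _ (\bigcup_n F n)).
  move=> x /= /existsNP[U] /not_implyP[oU] /not_implyP[Ux] /negP.
  rewrite -leNgt => muU0.
  have [e /= e0 eU] : exists2 e, 0 < e & ball x e `<=` U.
    by move: oU => /(_ x Ux) /nbhs_ballP.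
  have [|s] := @rat_in_itvoo R (x - e) x; first by rewrite ltrBlDr ltrDl.
  rewrite in_itv /= => /andP[s1 s2].
  have [|t] := @rat_in_itvoo R x (x + e); first by rewrite ltrDl.
  rewrite in_itv /= => /andP[t1 t2].
  exists (pickle (s, t)); first exact: Logic.I.
  rewrite /F pickleK.
  have IU : I (s, t) `<=` U.
    move=> z; rewrite /I /= in_itv /= => /andP[z1 z2]; apply: eU.
    rewrite /ball /= ltr_distl; lra.
  have -> : mu (I (s, t)) == 0%E.
    rewrite eq_le measure_ge0 andbT (le_trans _ muU0) //.
    by apply: le_measure => //; rewrite inE //; exact: open_measurable.
  by rewrite /I /= in_itv /= s2 t1.
apply: negligible_bigcup => n; rewrite /F.
case: unpickle => [u|]; last exact: negligible_set0.
case: eqP => [mu0|_]; last exact: negligible_set0.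
by apply/negligibleP => //; exact: measurable_itv.
Qed.

(** As the support carries all the mass, L(q) is the integral of |q|; were
    it zero, the open set where q is nonzero would be null, hence would miss the
    support, whose points would all be roots of q. *)
Lemma moment_positive a : infinite_set (measure_support mu) ->
  measure_support mu `<=` [set x | x <= a] ->
  forall q, q != 0 -> (forall x, x <= a -> 0 <= q.[x]) -> 0 < moment q.
Proof.
move=> infS Sa q q0 qge0.
have mq : measurable_fun setT (horner q) by exact: measurable_poly.
have mqE : measurable_fun setT (EFin \o horner q) by exact/measurable_EFinP.
have momE : (moment q)%:E = (\int[mu]_x `|(q.[x])%:E|)%E.
  rewrite /moment /Rintegral fineK; last exact/integrable_fin_num/integrable_poly.
  apply: ae_eq_integral => //; first exact: measurableT_comp.
  apply: negligibleS negligible_setC_support => x /= /not_implyP[_ qx] Sx.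
  by apply: qx; rewrite ger0_norm // qge0 //; exact: Sa.
rewrite lt_neqAle -!lee_fin momE integral_ge0 // andbT eq_sym; apply/eqP => m0.
have : (\int[mu]_x `|(EFin \o horner q) x|)%E = 0%E by rewrite -momE m0.
move/(ae_eq_integral_abs _ measurableT mqE) => q_ae0.
have [x [Sx qx]] : exists x, measure_support mu x /\ q.[x] != 0.
  apply: contrapT => /forallNP nex; apply: infS.
  apply: (@sub_finite_set _ _ [set` rootsR q]); last exact: finite_seq.
  move=> x Sx /=; rewrite mem_rootsR //; apply/rootP/eqP/negPn/negP => qx.
  by apply: (nex x).
have oU : open [set x | q.[x] != 0].
  apply: (@open_comp _ _ (horner q) [set y | y != 0]); last exact: open_neq.
  by move=> z _; exact: continuous_horner.
have := Sx _ oU qx; rewrite (_ : mu _ = 0%E) ?ltxx //.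
apply: measure_negligible; first exact: open_measurable.
apply: negligibleS q_ae0 => z /= qz; apply/not_implyP; split=> //.
by move=> [] /eqP; apply/negP.
Qed.

End moment_functional.

(** * Zeros of orthogonal polynomials with a point mass *)

Theorem theorem4 (R : realType) (mu : {measure set R -> \bar R})
    (hsupp : infinite_set (measure_support mu))
    (hmom : finite_moments mu)
    (xi eta : \bar R)
    (hhull : convex_hull (measure_support mu) =
             [set x : R | (xi <= x%:E <= eta)%E])
    (a : R) (ha : (eta <= a%:E)%E)
    (p pss : nat -> {poly R}) (pN : R -> nat -> {poly R})
    (hp : monic_OPS mu p)
    (hpss : monic_OPS (sq_weight mu a) pss)
    (hpN : forall N : {nonneg R}, 0 < N%:num ->
             monic_OPS (add_mass mu a N) (pN N%:num))
    (n : nat) (hn : (1 <= n)%N) :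
  let x k := zero_ (p n) k in
  let xN N k := zero_ (pN N n) k in
  let y k := zero_ (pss n.-1) k in
  let B := OPS_kernel mu p n.-1 a a in
  [/\ [/\ size (rootsR (p n)) = n,
          size (rootsR (pss n.-1)) = n.-1
        & forall N : R, 0 < N -> size (rootsR (pN N n)) = n],
      forall N : R, 0 < N ->
        (forall k, (1 <= k < n)%N ->
           [/\ x k < xN N k, xN N k < y k & y k < x k.+1]) /\
        x n < xN N n < a,
      forall k, (1 <= k <= n)%N ->
        forall N N' : R, 0 < N -> N < N' -> xN N k < xN N' k,
      xN N n @[N --> +oo] --> a /\
      (forall k, (1 <= k < n)%N -> xN N k @[N --> +oo] --> y k)
    & N * (a - xN N n) @[N --> +oo] -->
        (p n).[a] / (B * (pss n.-1).[a]) /\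
      (forall k, (1 <= k < n)%N ->
         N * (y k - xN N k) @[N --> +oo] -->
           (p n).[y k] / (B * (y k - a) * (pss n.-1)^`().[y k]))].
Proof.
case: n hn => // m _ x xN y; rewrite -[m.+1.-1]/m in y * => B.
have Sa : measure_support mu `<=` [set z | z <= a].
  move=> z /(@sub_gen_smallest _ (@convex_set R R^o)).
  rewrite -/(convex_hull _) hhull /= => /andP[_ zeta].
  by rewrite -lee_fin (le_trans zeta).
pose L : {scalar {poly R}} := HB.pack (moment mu)
  (GRing.isLinear.Build R {poly R} R *%R (moment mu) (moment_linear hmom)).
have Lpos : positive_left a L.
  by move=> q q0 qge0; exact: (moment_positive hmom hsupp Sa q0 qge0).
have [sp mp op] := hp.
have oL i j : i <> j -> L (p i * p j) = 0.
  by move=> ij; rewrite -[LHS](inner_moment mu) op.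
have opm : orthogonal_upto L m.+1 (p m.+1).
  by apply: OPS_orthogonal => // c q r; rewrite linearD linearZ.
set g := pss m in y *.
have [spss mpss opss] := hpss.
have sg : size g = m.+1 by exact: spss.
have mg : g \is monic by exact: mpss.
have og (r : {poly R}) : (size r < m.+1)%N -> L (g * ('X - a%:P) ^+ 2 * r) = 0.
  rewrite ltnS => szr; rewrite mulrAC.
  apply: (@OPS_orthogonal _ (fun q => L (q * ('X - a%:P) ^+ 2)) pss) szr => //.
    by move=> c q s; rewrite mulrDl -scalerAl linearD linearZ.
  by move=> i j ij; rewrite -[LHS](inner_sq_weight mu) opss.
have [sx x_lt_a] := orthogonal_all_roots Lpos (mp _) (sp _) opm.
have [sy xyx] := christoffel_interlacing Lpos (mp _) (sp _) opm mg sg og.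
(* The interlacing families of the pencil, counted from 0; the last zero of
   Q = (X - a) g is [a] itself. *)
pose X k := (rootsR (p m.+1))`_k.
pose Y k := if k == m then a else (rootsR g)`_k.
have XY k : (k < m.+1)%N -> X k < Y k.
  rewrite ltnS leq_eqVlt /Y; case: eqP => [-> _|_ /= km].
    by apply: x_lt_a; rewrite mem_nth ?sx.
  by have /andP[] := xyx k km.
have YX k : (k.+1 < m.+1)%N -> Y k < X k.+1.
  by move=> km; rewrite /Y ltn_eqF //; have /andP[] := xyx k km.
have nX : nodal m.+1 X = p m.+1 by rewrite [RHS](monic_prod_rootsR (mp _) (sp _) sx).
have nY : nodal m.+1 Y = ('X - a%:P) * g.
  rewrite [in RHS](monic_prod_rootsR mg sg sy) /nodal big_ord_recr /= mulrC.
  by rewrite /Y eqxx; congr (_ * _); apply: eq_bigr => i _; rewrite ltn_eqF.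
have BE : B = (kernel_at a L p m.+1).[a].
  rewrite /B /OPS_kernel /kernel_at horner_sum; apply: eq_bigr => j _.
  by rewrite hornerZ inner_moment mulrAC.
have B0 : 0 < B by rewrite BE (kernel_at_gt0 Lpos).
have pNE N : 0 < N -> rootsR (pN N m.+1) = rootsR (pencil m.+1 X Y (N * B)).
  move=> N0; have [sN mN oN] := hpN (NngNum (ltW N0)) N0.
  have oNr (r : {poly R}) : (size r <= m.+1)%N ->
      L (pN N m.+1 * r) + N * (pN N m.+1 * r).[a] = 0.
    apply: (@OPS_orthogonal _ (fun q => L q + N * q.[a]) (pN N)) => //.
      move=> c q s; rewrite linearD linearZ hornerD hornerZ /=; ring.
    by move=> i j /(oN i j); rewrite inner_add_mass.
  have := mass_point_pencil Lpos sp mp oL (ltn0Sn m) mg sg og N0 (mN _) (sN _) oNr.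
  rewrite -BE -nX -nY -/(pencil _ _ _ _) => E.
  have NB : 0 < 1 + N * B by rewrite addr_gt0 // mulr_gt0.
  rewrite -E; apply: eq_rootsR.
  - exact: monic_neq0.
  - by rewrite scaler_eq0 negb_or gt_eqF //= monic_neq0.
  - by move=> z; rewrite rootZ // gt_eqF.
have cN N : 0 < N -> 0 < N * B by move=> N0; rewrite mulr_gt0.
have near_xN k : {near +oo, (fun N => xN N k.+1) =1
    (fun N => (rootsR (pencil m.+1 X Y (N * B)))`_k)}.
  near=> N; have N0 : 0 < N by near: N; apply: nbhs_pinfty_gt; rewrite num_real.
  by rewrite /xN /zero_ pNE.
have cvg_xN k : (k < m.+1)%N -> xN N k.+1 @[N --> +oo] --> Y k.
  move=> km; apply: cvg_trans (pencil_zero_cvg XY YX B0 km).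
  by apply: near_eq_cvg; apply: filterS (near_xN k) => N ->.
have rate_xN k : (k < m.+1)%N -> N * (Y k - xN N k.+1) @[N --> +oo] -->
    (p m.+1).[Y k] / (B * (g.[Y k] + (Y k - a) * g^`().[Y k])).
  move=> km; have := pencil_zero_rate XY YX B0 km.
  rewrite nX nY derivM derivXsubC mul1r.
  rewrite hornerD hornerM hornerXsubC; apply: cvg_trans.
  by apply: near_eq_cvg; apply: filterS (near_xN k) => N ->.
have Ym : Y m = a by rewrite /Y eqxx.
have Yk k : (k < m)%N -> Y k = y k.+1 by move=> km; rewrite /Y ltn_eqF.
have gy k : (k < m)%N -> g.[y k.+1] = 0.
  by move=> km; apply/rootP; rewrite -mem_rootsR ?mem_nth ?sy // monic_neq0.
split.
- split=> // N N0; rewrite pNE //.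
  by have [] := pencil_zeros XY YX (cN _ N0).
- move=> N N0; have [_ zP] := pencil_zeros XY YX (cN _ N0).
  split; last by rewrite /xN /zero_ pNE //= -[X in _ < _ < X]Ym; exact: zP.
  case=> // k; rewrite ltnS => /= km; have /andP[h1 h2] := zP k (ltnW km).
  rewrite /xN /zero_ pNE //= -Yk //; split=> //.
  exact: YX.
- case=> // k /= km N N' N0 NN'.
  have N'0 := lt_trans N0 NN'.
  rewrite /xN /zero_ !pNE //=.
  by apply: (pencil_zero_increasing XY YX); rewrite ?cN // ltr_pM2r.
- split; first by rewrite -[X in _ --> X]Ym; exact: cvg_xN.
  by case=> // k; rewrite ltnS => /= km; rewrite -Yk //; apply: cvg_xN; exact: ltnW.
- split.
    have := rate_xN m (ltnSn m); rewrite Ym subrr mul0r addr0; exact.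
  case=> // k; rewrite ltnS => /= km.
  have := rate_xN k (ltnW km); rewrite Yk // gy // add0r mulrA; exact.
Unshelve. all: by end_near. Qed.
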